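(* Let $m,n\ge 1$, let $\mathbb K$ be a field, $q\in\mathbb K^*$, let $\mathcal A$ be a $\mathbb K$-algebra, and let $\mathcal A^*$ be the set of invertible elements of $\mathcal A$. Let $f_0:Pint_{m,n}\to\mathcal A^*$ be a function satisfying the quasi-commutation relations on $Pint_{m,n}$, i.e. for all $(I|J),(I'|J')\in Pint_{m,n}$ with $|I|\ge|I'|$, $$f_0(I|J)\,f_0(I'|J')=q^{c}f_0(I'|J')\,f_0(I|J),\qquad c=\beta+\delta-\alpha-\gamma,$$ where $\alpha=|\{i'\in I': i'<\min I\}|$, $\beta=|\{i'\in I': i'>\max I\}|$, $\gamma=|\{j'\in J': j'<\min J\}|$, $\delta=|\{j'\in J': j'>\max J\}|$. Then $f_0$ is extendable to a QI-function $f:\mathcal E^{m,n}\to\mathcal A$ (normalized by $f(\emptyset|\emptyset)=1$).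
   Context: Algebras are associative and unital, not necessarily commutative. $[n']=\{1,\dots,n'\}$. An interval in $[n']$ is a set $\{a,a+1,\dots,b\}$ with $1\le a\le b\le n'$. $\mathcal E^{m,n}$ is the set of pairs (corteges) $(I|J)$ with $I\subseteq[m]$, $J\subseteq[n]$, $|I|=|J|$. $Pint_{m,n}$ (pressed interval corteges) is the set of $(I|J)\in\mathcal E^{m,n}$ such that $I,J$ are both intervals and at least one of $I=[|I|]$, $J=[|J|]$ holds. Fine $q$-matrix: an $m\times n$ matrix $X=(x_{ij})$ over a $\mathbb K$-algebra such that for all $i<\ell\le m$ and $j<k\le n$ (and, in the first two relations, all admissible values of the remaining index): $x_{ij}x_{ik}=q x_{ik}x_{ij}$, $x_{ij}x_{\ell j}=q x_{\ell j}x_{ij}$, $x_{ik}x_{\ell j}=x_{\ell j}x_{ik}$, $x_{ij}x_{\ell k}-x_{\ell k}x_{ij}=(q-q^{-1})x_{ik}x_{\ell j}$. $q$-minor: for $(I|J)\in\mathcal E^{m,n}$ with $I=\{i_1<\dots<i_k\}$, $J=\{j_1<\dots<j_k\}$, $$\Delta_{X,q}(I|J)=\sum_{\sigma\in S_k}(-q)^{\ell(\sigma)}x_{i_1j_{\sigma(1)}}x_{i_2j_{\sigma(2)}}\cdots x_{i_kj_{\sigma(k)}},$$ where $\ell(\sigma)$ is the number of inversions of $\sigma$; $\Delta(\emptyset|\emptyset)=1$. Universal quadratic identity (universal QI) for given $m,n$: a formal expression $\sum_{i=1}^N \mathrm{sign}_i\,q^{\delta_i}\Delta(I_i|J_i)\Delta(I'_i|J'_i)=0$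 with $\mathrm{sign}_i\in\{+,-\}$, $\delta_i\in\mathbb Z$, $(I_i|J_i),(I'_i|J'_i)\in\mathcal E^{m,n}$ (repetitions allowed), which is homogeneous (each of $I_i\cup I'_i$, $I_i\cap I'_i$, $J_i\cup J'_i$, $J_i\cap J'_i$ does not depend on $i$), and which holds for the $q$-minors $\Delta=\Delta_{X,q}$ of every $m\times n$ fine $q$-matrix $X$ over every $\mathbb K$-algebra, for every field $\mathbb K$ and every $q\in\mathbb K^*$. QI-function: a function $f:\mathcal E^{m,n}\to\mathcal A$ such that for every universal QI, the identity obtained by formally replacing each $\Delta(I|J)$ by $f(I|J)$ holds in $\mathcal A$ (with the given $q$). All functions on $\mathcal E^{m,n}$ are assumed normalized: $f(\emptyset|\emptyset)=1$. *)

(* Defs.v *)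
From mathcomp Require Import all_boot all_order all_algebra all_fingroup.

Set Implicit Arguments.
Unset Strict Implicit.
Unset Printing Implicit Defensive.

Import Order.TTheory GRing.Theory Num.Theory.

Local Open Scope ring_scope.

(* Row and column indices are 0-based: [n] is represented by 'I_n, the index
   i in [n] by the ordinal of value i - 1. *)

Definition cortege (m n : nat) : Type :=
  {c : {set 'I_m} * {set 'I_n} | #|c.1| == #|c.2|}.

Definition rows (m n : nat) (c : cortege m n) : {set 'I_m} := (sval c).1.
Definition cols (m n : nat) (c : cortege m n) : {set 'I_n} := (sval c).2.

Lemma card_rows_cols (m n : nat) (c : cortege m n) : #|rows c| = #|cols c|.
Proof. exact: (eqP (svalP c)). Qed.

Lemma cortege0_subproof (m n : nat) :
  #|(set0 : {set 'I_m}, set0 : {set 'I_n}).1|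
  == #|(set0 : {set 'I_m}, set0 : {set 'I_n}).2|.
Proof. by rewrite !cards0. Qed.

Definition cortege0 (m n : nat) : cortege m n :=
  exist _ (set0, set0) (cortege0_subproof m n).

(* Intervals are nonempty. *)
Definition interval (n : nat) (I : {set 'I_n}) : bool :=
  [exists a : 'I_n, exists b : 'I_n,
    (a <= b)%N && (I == [set i : 'I_n | (a <= i <= b)%N])].

Definition pressed (n : nat) (I : {set 'I_n}) : bool :=
  I == [set i : 'I_n | (i < #|I|)%N].

Definition pressed_interval (m n : nat) (c : cortege m n) : bool :=
  [&& interval (rows c), interval (cols c)
    & pressed (rows c) || pressed (cols c)].

Definition pint (m n : nat) : Type := {c : cortege m n | pressed_interval c}.

Definition pint_cortege (m n : nat) (p : pint m n) : cortege m n := sval p.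
Coercion pint_cortege : pint >-> cortege.

Definition fine_qmatrix (K : fieldType) (A : algType K) (m n : nat) (q : K)
    (X : 'M[A]_(m, n)) : Prop :=
  [/\ forall (i : 'I_m) (j k : 'I_n), (j < k)%N ->
        X i j * X i k = q *: (X i k * X i j),
      forall (i l : 'I_m) (j : 'I_n), (i < l)%N ->
        X i j * X l j = q *: (X l j * X i j),
      forall (i l : 'I_m) (j k : 'I_n), (i < l)%N -> (j < k)%N ->
        X i k * X l j = X l j * X i k
    & forall (i l : 'I_m) (j k : 'I_n), (i < l)%N -> (j < k)%N ->
        X i j * X l k - X l k * X i j = (q - q^-1) *: (X i k * X l j)].

Definition inversions (k : nat) (s : 'S_k) : nat :=
  #|[set p : 'I_k * 'I_k | (p.1 < p.2)%N && (s p.2 < s p.1)%N]|.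

(* For I : {set 'I_n}, the function enum_val : 'I_#|I| -> 'I_n lists I in
   increasing order; the big product runs over its index from left to right. *)
Definition qminor (K : fieldType) (A : algType K) (m n : nat) (q : K)
    (X : 'M[A]_(m, n)) (c : cortege m n) : A :=
  \sum_(s : 'S_#|rows c|)
    (- q) ^+ inversions s *:
      \prod_(t < #|rows c|)
        X (enum_val t) (enum_val (cast_ord (card_rows_cols c) (s t))).

(* The formal term  (-1)^neg q^expo Delta(left) Delta(right). *)
Record qi_term (m n : nat) : Type := QITerm {
  qi_neg : bool;
  qi_expo : int;
  qi_left : cortege m n;
  qi_right : cortege m n }.

Definition homogeneous (m n N : nat) (e : 'I_N -> qi_term m n) : Prop :=
  forall i j : 'I_N,
  [/\ rows (qi_left (e i)) :|: rows (qi_right (e i))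
        = rows (qi_left (e j)) :|: rows (qi_right (e j)),
      rows (qi_left (e i)) :&: rows (qi_right (e i))
        = rows (qi_left (e j)) :&: rows (qi_right (e j)),
      cols (qi_left (e i)) :|: cols (qi_right (e i))
        = cols (qi_left (e j)) :|: cols (qi_right (e j))
    & cols (qi_left (e i)) :&: cols (qi_right (e i))
        = cols (qi_left (e j)) :&: cols (qi_right (e j))].

Definition qi_holds (K : fieldType) (A : algType K) (m n N : nat) (q : K)
    (f : cortege m n -> A) (e : 'I_N -> qi_term m n) : Prop :=
  \sum_(i < N) ((-1) ^+ qi_neg (e i) * q ^ qi_expo (e i)) *:
    (f (qi_left (e i)) * f (qi_right (e i))) = 0.

Definition universal_QI (m n N : nat) (e : 'I_N -> qi_term m n) : Prop :=
  homogeneous e /\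
  forall (K : fieldType) (q : K) (A : algType K) (X : 'M[A]_(m, n)),
    q != 0 -> fine_qmatrix q X -> qi_holds q (qminor q X) e.

Definition QI_function (K : fieldType) (A : algType K) (m n : nat) (q : K)
    (f : cortege m n -> A) : Prop :=
  f (cortege0 m n) = 1 /\
  forall (N : nat) (e : 'I_N -> qi_term m n),
    universal_QI e -> qi_holds q f e.

(* algType carries no unit structure, so GRing.unit is not available. *)
Definition invertible (R : nzRingType) (a : R) : Prop :=
  exists b : R, a * b = 1 /\ b * a = 1.

(* Minimum and maximum of a nonempty I; junk values for set0. *)
Definition set_min (n : nat) (I : {set 'I_n}) : nat :=
  \big[minn/n]_(i in I) (i : nat).
Definition set_max (n : nat) (I : {set 'I_n}) : nat :=
  \max_(i in I) (i : nat).

Definition card_below (n : nat) (I I' : {set 'I_n}) : nat :=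
  #|[set i in I' | (i < set_min I)%N]|.
Definition card_above (n : nat) (I I' : {set 'I_n}) : nat :=
  #|[set i in I' | (set_max I < i)%N]|.

(* beta + delta - alpha - gamma *)
Definition qc_exponent (m n : nat) (c c' : cortege m n) : int :=
  (card_above (rows c) (rows c'))%:Z + (card_above (cols c) (cols c'))%:Z
  - (card_below (rows c) (rows c'))%:Z - (card_below (cols c) (cols c'))%:Z.

Definition quasi_commuting (K : fieldType) (A : algType K) (m n : nat) (q : K)
    (f0 : pint m n -> A) : Prop :=
  forall p p' : pint m n, (#|rows p'| <= #|rows p|)%N ->
    f0 p * f0 p' = q ^ qc_exponent p p' *: (f0 p' * f0 p).

(* Main.v *)
Require Import Defs.
From mathcomp Require Import all_boot all_order all_algebra all_fingroup.
From mathcomp Require Import zify ring.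
Import GRing.Theory.
Local Open Scope ring_scope.

(** Let F(i,j) be the prescribed value at the pressed interval cortege whose
    largest row is i and largest column is j.  The ratios
    T(i,j) = F(i-1,j-1)^-1 F(i,j) q-commute along rows and along columns and
    commute otherwise.  From such a family a fine q-matrix X is built by adding
    rows on top, starting from the bottom one: if Y is the matrix built from
    all rows of T but the first row a, then X has first row a and
    X(i+1,j) = (sum_(p <= j) Y(i,p) a(p)^-1) a(j), that is,
    X(i+1,j+1) = Y(i,j+1) + X(i+1,j) a(j)^-1 a(j+1).  Column operations that
    leave q-minors unchanged therefore reduce each pressed interval q-minor of
    X to a q-minor of Y, and its value is the diagonal product
    T(i-k+1,j-k+1) ... T(i,j) = F(i,j).  The q-minors of a fine q-matrix form
    a QI-function. *)

Set Implicit Arguments.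
Unset Strict Implicit.
Unset Printing Implicit Defensive.

(** * Calculus of q-commuting elements *)

Section QComm.
Variables (K : fieldType) (A : algType K).
Implicit Types (e : K) (x y z : A).

Definition qcomm e x y : Prop := x * y = e *: (y * x).

Lemma qcomm1l y : qcomm 1 1 y.
Proof. by rewrite /qcomm mul1r mulr1 scale1r. Qed.

Lemma qcomm1r x : qcomm 1 x 1.
Proof. by rewrite /qcomm mul1r mulr1 scale1r. Qed.

Lemma qcommMl e1 e2 x1 x2 y :
  qcomm e1 x1 y -> qcomm e2 x2 y -> qcomm (e1 * e2) (x1 * x2) y.
Proof.
rewrite /qcomm => h1 h2.
rewrite -mulrA h2 -scalerAr (mulrA x1) h1 -scalerAl scalerA -mulrA.
by rewrite [e2 * _]mulrC.
Qed.

Lemma qcommMr e1 e2 x y1 y2 :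
  qcomm e1 x y1 -> qcomm e2 x y2 -> qcomm (e1 * e2) x (y1 * y2).
Proof.
rewrite /qcomm => h1 h2.
by rewrite mulrA h1 -scalerAl -(mulrA y1 x) h2 -scalerAr scalerA mulrA.
Qed.

Lemma qcomm_sym e x y : e != 0 -> qcomm e x y -> qcomm e^-1 y x.
Proof. by rewrite /qcomm => e0 ->; rewrite scalerA mulVf // scale1r. Qed.

Lemma qcommVl e x x' y : e != 0 -> x * x' = 1 -> x' * x = 1 ->
  qcomm e x y -> qcomm e^-1 x' y.
Proof.
rewrite /qcomm => e0 xx' x'x h.
rewrite -[x' * y]mulr1 -xx' mulrA -(mulrA x' y).
have -> : y * x = e^-1 *: (x * y) by rewrite h scalerA mulVf // scale1r.
by rewrite -scalerAr -scalerAl mulrA x'x mul1r.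
Qed.

Lemma qcommVr e x y y' : e != 0 -> y * y' = 1 -> y' * y = 1 ->
  qcomm e x y -> qcomm e^-1 x y'.
Proof.
move=> e0 yy' y'y h; rewrite -[e^-1]invrK.
by apply: qcomm_sym; rewrite ?invr_eq0 ?invrK //; rewrite -[e]invrK;
   apply: qcommVl yy' y'y _; rewrite ?invr_eq0 //; apply: qcomm_sym.
Qed.

Lemma qcomm_sumr (I : Type) (r : seq I) (P : pred I) (F : I -> A) e x :
  (forall i, P i -> qcomm e x (F i)) -> qcomm e x (\sum_(i <- r | P i) F i).
Proof.
move=> h; rewrite /qcomm mulr_sumr mulr_suml scaler_sumr.
by apply: eq_bigr => i /h.
Qed.

Lemma qcomm_suml (I : Type) (r : seq I) (P : pred I) (F : I -> A) e y :
  (forall i, P i -> qcomm e (F i) y) -> qcomm e (\sum_(i <- r | P i) F i) y.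
Proof.
move=> h; rewrite /qcomm mulr_sumr mulr_suml scaler_sumr.
by apply: eq_bigr => i /h.
Qed.

End QComm.

Section FineMatrices.
Variables (K : fieldType) (A : algType K) (q : K).
Hypothesis q0 : q != 0.

Definition fine_on (m n : nat) (X : nat -> nat -> A) : Prop :=
  [/\ forall i j k, (i < m)%N -> (j < k < n)%N -> qcomm q (X i j) (X i k),
      forall i l j, (i < l < m)%N -> (j < n)%N -> qcomm q (X i j) (X l j),
      forall i l j k, (i < l < m)%N -> (j < k < n)%N ->
        qcomm 1 (X i k) (X l j)
    & forall i l j k, (i < l < m)%N -> (j < k < n)%N ->
        X i j * X l k - X l k * X i j = (q - q^-1) *: (X i k * X l j)].

(** ** Fine q-matrices from rows added on top *)

(* Entries of two columns of [add_row] have the form [s * a] and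
   [(s + d) * b], where [a], [b] are the entries of the new row, [s] is a
   partial sum and [s + d] a longer one; primes refer to a lower row. *)
Section TwoColumns.
Variables (a b : A).
Hypothesis ab : qcomm q a b.

Lemma left_column_qcomm s : qcomm q a s -> qcomm q a (s * a).
Proof.
move=> h; rewrite -[q]mulr1; apply: qcommMr h _.
by rewrite /qcomm scale1r.
Qed.

Lemma right_over_left_comm s : qcomm q b s -> qcomm 1 b (s * a).
Proof.
by move=> h; rewrite -(divff q0); apply: qcommMr h _; apply: qcomm_sym.
Qed.

Lemma top_row_diagonal s d : qcomm q a s -> qcomm q^-1 a d -> qcomm q b s ->
  a * ((s + d) * b) - (s + d) * b * a = (q - q^-1) *: (b * (s * a)).
Proof.
move=> as_ ad bs.
have sab : a * (s * b) = (q * q) *: (s * b * a) by apply: qcommMr as_ ab.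
have dab : a * (d * b) = d * b * a.
  by rewrite (qcommMr ad ab) mulVf // scale1r.
rewrite !mulrDl mulrDr dab opprD addrACA subrr addr0 sab [b * _]mulrA bs.
rewrite -scalerAl scalerA -[X in _ - X]scale1r -scalerBl.
by congr (_ *: _); field.
Qed.

Let swap_ab x : x * a * b = q *: (x * b * a).
Proof. by rewrite -mulrA ab -scalerAr mulrA. Qed.

(** [absorb] and [slide] bring products of two entries to words ending in [b * a]. The three
    relations below then only compare words in the partial sums. *)
Let absorb x s d : qcomm q a s -> qcomm q^-1 a d ->
  x * a * ((s + d) * b) = (q * q) *: (x * s * b * a) + x * d * b * a.
Proof.
move=> as_ ad; rewrite [(s + d) * b]mulrDl mulrDr; congr (_ + _).
  rewrite mulrA -(mulrA x) as_ -scalerAr -scalerAl mulrA swap_ab.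
  by rewrite scalerA.
rewrite mulrA -(mulrA x) ad -scalerAr -scalerAl mulrA swap_ab.
by rewrite scalerA mulVf // scale1r.
Qed.

Let slide x s : qcomm q b s -> x * b * (s * a) = q *: (x * s * b * a).
Proof.
by move=> bs; rewrite mulrA -(mulrA x) bs -scalerAr -scalerAl !mulrA.
Qed.

Lemma row_relation s d : qcomm q a s -> qcomm q^-1 a d -> qcomm q b s ->
  qcomm (q * q) s d -> qcomm q (s * a) ((s + d) * b).
Proof.
move=> as_ ad bs sd; rewrite /qcomm absorb // slide // sd -!scalerAl.
by rewrite scalerA -scalerDr -!mulrDl.
Qed.

Lemma antidiagonal_relation s d s' : qcomm q a s -> qcomm q^-1 a d ->
    qcomm q b s' -> qcomm q s s' -> qcomm q^-1 d s' ->
  qcomm 1 ((s + d) * b) (s' * a).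
Proof.
move=> as_ ad bs ss ds; rewrite /qcomm scale1r absorb // slide //.
rewrite 3!mulrDl ss ds -!scalerAl scalerDr !scalerA mulfV // scale1r.
by [].
Qed.

Lemma diagonal_relation s d s' d' :
    qcomm q a s' -> qcomm q^-1 a d' -> qcomm q b s -> qcomm q b s' ->
    qcomm q s s' ->
    s * d' = q *: (d' * s) + (q * q - 1) *: (d * s') ->
  s * a * ((s' + d') * b) - (s' + d') * b * (s * a)
    = (q - q^-1) *: ((s + d) * b * (s' * a)).
Proof.
move=> as_ ad bs bs' ss sd; rewrite absorb // !slide // sd ss.
rewrite !mulrDl ss !scalerDr -!scalerAl !scalerA opprD.
rewrite addrA addrAC -!addrA [_ *: (d' * s * b * a) + _]addrC !addrA.
rewrite addrAC subrK addrAC -scalerBl; congr (_ *: _ + _ *: _); by field.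
Qed.
End TwoColumns.

Definition add_row (a a' : nat -> A) (Y : nat -> nat -> A) (i j : nat) : A :=
  if i is i'.+1 then (\sum_(0 <= p < j.+1) Y i' p * a' p) * a j else a j.

Section AddRow.
Variables (m n : nat) (a a' : nat -> A) (Y : nat -> nat -> A).
Hypotheses (aa' : forall j, (j < n)%N -> a j * a' j = 1)
  (a'a : forall j, (j < n)%N -> a' j * a j = 1).
Hypothesis a_row : forall j k, (j < k < n)%N -> qcomm q (a j) (a k).
Hypothesis aY : forall j i p, (i < m)%N -> (j < n)%N -> (p < n)%N ->
  qcomm (if j == p then q else 1) (a j) (Y i p).
Hypothesis Y_fine : fine_on m n Y.

(** Dividing column p of Y by a(p) twists the fine relations: the factor becomes q^2 along rows,
    stays q down columns, and becomes q^-1 on antidiagonals. The two-column lemmas are applied with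
    [s = B i 0 j.+1] and [d = B i j.+1 k.+1]. *)
Let Z i p := Y i p * a' p.
Let B i u v := \sum_(u <= p < v) Z i p.

Let weight_neq0 (b : bool) : (if b then q else 1) != 0.
Proof. by case: b => //; apply: oner_neq0. Qed.

Let Ya' i p r : (i < m)%N -> (p < n)%N -> (r < n)%N ->
  qcomm (if r == p then q else 1) (Y i p) (a' r).
Proof.
move=> im pn rn; rewrite -[if _ then _ else _]invrK.
apply: (qcommVr _ (aa' rn) (a'a rn)); rewrite ?invr_eq0 ?weight_neq0 //.
by apply: qcomm_sym; rewrite ?weight_neq0 //; apply: aY.
Qed.

Let a'Y i p r : (i < m)%N -> (p < n)%N -> (r < n)%N ->
  qcomm (if r == p then q else 1)^-1 (a' r) (Y i p).
Proof.
move=> im pn rn; apply: qcomm_sym; rewrite ?weight_neq0 //.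
exact: Ya'.
Qed.

Let aa'_lt p j : (p < j < n)%N -> qcomm q (a j) (a' p).
Proof.
move=> pj; have pn : (p < n)%N by lia.
rewrite -[X in qcomm X]invrK; apply: (qcommVr _ (aa' pn) (a'a pn)).
  by rewrite invr_eq0.
by apply: qcomm_sym => //; apply: a_row.
Qed.

Let aa'_gt p j : (j < p < n)%N -> qcomm q^-1 (a j) (a' p).
Proof.
move=> jp; have pn : (p < n)%N by lia.
by apply: (qcommVr _ (aa' pn) (a'a pn)) => //; apply: a_row.
Qed.

Let a'_row p r : (p < r < n)%N -> qcomm q (a' p) (a' r).
Proof.
move=> pr; have pn : (p < n)%N by lia.
have rn : (r < n)%N by lia.
rewrite -[X in qcomm X]invrK; apply: (qcommVl _ (aa' pn) (a'a pn)).
  by rewrite invr_eq0.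
by apply: aa'_gt.
Qed.

Let aZ_le i p j : (i < m)%N -> (p <= j < n)%N -> qcomm q (a j) (Z i p).
Proof.
move=> im pj; have [jn pn] : (j < n)%N /\ (p < n)%N by lia.
have hY := aY im jn pn; case: (ltngtP p j) pj hY => // [pj _|<- _].
- move=> hY; rewrite -[q]mul1r; apply: qcommMr hY _; apply: aa'_lt; lia.
- move=> hY; rewrite -[q]mulr1; apply: qcommMr hY _.
  by rewrite /qcomm scale1r aa' ?a'a.
Qed.

Let aZ_gt i p j : (i < m)%N -> (j < p < n)%N -> qcomm q^-1 (a j) (Z i p).
Proof.
move=> im jp; have [jn pn] : (j < n)%N /\ (p < n)%N by lia.
have := aY im jn pn; rewrite ltn_eqF; last by lia.
by move=> hY; rewrite -[q^-1]mul1r; apply: qcommMr hY _; apply: aa'_gt.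
Qed.

Let Z_row i p r : (i < m)%N -> (p < r < n)%N -> qcomm (q * q) (Z i p) (Z i r).
Proof.
move=> im pr; have [rn pn] : (r < n)%N /\ (p < n)%N by lia.
have [Y1 _ _ _] := Y_fine.
have h1 : qcomm q (Z i p) (Y i r).
  rewrite -[q]mulr1; apply: qcommMl; first exact: Y1.
  by have := a'Y im rn pn; rewrite ltn_eqF ?invr1 //; lia.
apply: qcommMr h1 _; rewrite -[q]mul1r; apply: qcommMl; last exact: a'_row.
by have := Ya' im pn rn; rewrite gtn_eqF //; lia.
Qed.

Let Z_col i l p : (i < l < m)%N -> (p < n)%N -> qcomm q (Z i p) (Z l p).
Proof.
move=> il pn; have [im lm] : (i < m)%N /\ (l < m)%N by lia.
have [_ Y2 _ _] := Y_fine.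
have h1 : qcomm 1 (Z i p) (Y l p).
  rewrite -(divff q0); apply: qcommMl; first exact: Y2.
  by have := a'Y lm pn pn; rewrite eqxx.
rewrite -[q]mul1r; apply: qcommMr h1 _; rewrite -[q]mulr1; apply: qcommMl.
  by have := Ya' im pn pn; rewrite eqxx.
by rewrite /qcomm scale1r.
Qed.

Let Z_anti i l p r : (i < l < m)%N -> (p < r < n)%N ->
  qcomm q^-1 (Z i r) (Z l p).
Proof.
move=> il pr; have [im lm] : (i < m)%N /\ (l < m)%N by lia.
have [rn pn] : (r < n)%N /\ (p < n)%N by lia.
have [_ _ Y3 _] := Y_fine.
have h1 : qcomm 1 (Z i r) (Y l p).
  rewrite -[1]mulr1; apply: qcommMl; first exact: Y3.
  by have := a'Y lm pn rn; rewrite gtn_eqF ?invr1 //; lia.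
rewrite -[q^-1]mul1r; apply: qcommMr h1 _; rewrite -[q^-1]mul1r; apply: qcommMl.
  by have := Ya' im rn pn; rewrite ltn_eqF //; lia.
by apply: qcomm_sym => //; apply: a'_row.
Qed.

Let Z_diag i l p r : (i < l < m)%N -> (p < r < n)%N ->
  Z i p * Z l r = q *: (Z l r * Z i p) + (q * q - 1) *: (Z i r * Z l p).
Proof.
move=> il pr; have [im lm] : (i < m)%N /\ (l < m)%N by lia.
have [rn pn] : (r < n)%N /\ (p < n)%N by lia.
have [_ _ _ Y4] := Y_fine.
(* In distinct columns a(s)^-1 commutes with Y(v,t), so both inverses collect on the right.
   Exchanging them there gives the factor q, and q (q - q^-1) = q^2 - 1. *)
have mv u v s t : (u < m)%N -> (v < m)%N -> (s < n)%N -> (t < n)%N -> s != t ->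
  Z u s * Z v t = Y u s * Y v t * (a' s * a' t).
  move=> um vm sn tn st; have := a'Y vm tn sn.
  rewrite (negPf st) invr1 /qcomm scale1r /Z => e.
  by rewrite -!mulrA; congr (_ * _); rewrite !mulrA e.
have pr' : p != r by rewrite neq_ltn; lia.
rewrite !mv // 1?eq_sym // (a'_row pr) -scalerAr scalerAl.
have -> : Y i p * Y l r = Y l r * Y i p + (q - q^-1) *: (Y i r * Y l p).
  by rewrite -Y4 // addrC subrK.
rewrite scalerDr mulrDl -!scalerAl scalerA; congr (_ + _ *: _).
by field.
Qed.

Let B_cat i u v w : (u <= v <= w)%N -> B i u w = B i u v + B i v w.
Proof. by move=> /andP[uv vw]; rewrite /B (big_cat_nat uv vw). Qed.

Let B_row i u v w : (i < m)%N -> (v <= w <= n)%N ->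
  qcomm (q * q) (B i u v) (B i v w).
Proof.
move=> im vw; rewrite /B !big_nat; apply: qcomm_suml => p pv.
apply: qcomm_sumr => r rw.
by apply: Z_row => //; lia.
Qed.

Let B_anti i l u v w x : (i < l < m)%N -> (v <= w)%N -> (x <= n)%N ->
  qcomm q^-1 (B i w x) (B l u v).
Proof.
move=> im vw xn; rewrite /B !big_nat; apply: qcomm_suml => p pv.
apply: qcomm_sumr => r rw.
by apply: Z_anti => //; lia.
Qed.

Let B_diag i l u v w x : (i < l < m)%N -> (v <= w)%N -> (x <= n)%N ->
  B i u v * B l w x = q *: (B l w x * B i u v)
                      + (q * q - 1) *: (B i w x * B l u v).
Proof.
move=> il vw xn; rewrite /B !big_nat !mulr_suml.
transitivity (\sum_(u <= p < v | (u <= p < v)%N)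
  \sum_(w <= r < x | (w <= r < x)%N)
   (q *: (Z l r * Z i p) + (q * q - 1) *: (Z i r * Z l p))).
  apply: eq_bigr => p pu; rewrite mulr_sumr; apply: eq_bigr => r rw.
  by apply: Z_diag => //; lia.
rewrite exchange_big !scaler_sumr -big_split; apply: eq_bigr => r rw.
by rewrite big_split /= !mulr_sumr !scaler_sumr.
Qed.

(** The cross terms do not q-commute one by one. The correction (q^2 - 1) [B i v v.+1 * B l 0 v]
    from [B_diag] joins the other cross term, which thus gets the coefficient q^2, and [B_anti]
    turns this into q^2 q^-1 = q. *)
Let B_col i l v : (i < l < m)%N -> (v <= n)%N -> qcomm q (B i 0 v) (B l 0 v).
Proof.
move=> il; elim: v => [|v IH] vn.
  by rewrite /B !big_geq // /qcomm !mulr0 scaler0.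
have vv : (0 <= v <= v.+1)%N by lia.
rewrite /qcomm !(B_cat _ vv) !mulrDl !mulrDr IH; last by lia.
have hc : qcomm q (B i v v.+1) (B l v v.+1).
  by rewrite /B !big_nat1; apply: Z_col.
rewrite hc (B_diag 0 il (leqnn v) vn) (B_anti 0 il (leqnn v) vn).
rewrite !scalerDr !scalerA.
rewrite -!addrA; congr (_ + _).
rewrite [RHS]addrCA; congr (_ + _); rewrite addrA -scalerDl; congr (_ *: _ + _).
by field.
Qed.

Lemma add_row_fine : fine_on m.+1 n (add_row a a' Y).
Proof.
have aS i j : (i < m)%N -> (j < n)%N -> forall k, (k <= j)%N ->
    qcomm q (a j) (B i 0 k.+1).
  move=> im jn k kj; rewrite /B big_nat; apply: qcomm_sumr => p pk.
  by apply: aZ_le => //; lia.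
have aD i j k : (i < m)%N -> (k < n)%N -> qcomm q^-1 (a j) (B i j.+1 k.+1).
  move=> im kn; rewrite /B big_nat; apply: qcomm_sumr => p pk.
  by apply: aZ_gt => //; lia.
have cat i j k : (j < k)%N -> B i 0 k.+1 = B i 0 j.+1 + B i j.+1 k.+1.
  by move=> jk; apply: B_cat; lia.
split.
- move=> [|i] j k im jk /=; first exact: a_row.
  rewrite -!/(B i 0 _) (cat i j k); last by lia.
  apply: row_relation; try exact: a_row;
    try (apply: aS; lia); try (apply: aD; lia).
  by apply: B_row; lia.
- move=> [|i] [|l] j // il jn /=.
    by apply: left_column_qcomm; apply: aS; lia.
  rewrite -!/(B _ 0 _) /qcomm.
  have h := aS l j ltac:(lia) jn j (leqnn j).
  have h' := aS i j ltac:(lia) jn j (leqnn j).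
  rewrite -!mulrA !(mulrA (a j)) h h'.
  rewrite -!scalerAl -!scalerAr !mulrA.
  have hB : qcomm q (B i 0 j.+1) (B l 0 j.+1) by apply: B_col; lia.
  by rewrite hB -!scalerAl.
- move=> [|i] [|l] j k // il jk /=.
    by apply: right_over_left_comm; [apply: a_row | apply: aS; lia].
  rewrite -!/(B _ 0 _) (cat i j k); last by lia.
  apply: antidiagonal_relation; try exact: a_row;
    try (apply: aS; lia); try (apply: aD; lia).
    by apply: B_col; lia.
  by apply: B_anti; lia.
- move=> [|i] [|l] j k // il jk /=.
    rewrite -!/(B _ 0 _) (cat l j k); last by lia.
    by apply: top_row_diagonal; try exact: a_row;
    try (apply: aS; lia); try (apply: aD; lia).
  rewrite -!/(B _ 0 _) (cat i j k) ?(cat l j k); try lia.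
  apply: diagonal_relation; try exact: a_row;
    try (apply: aS; lia); try (apply: aD; lia).
    by apply: B_col; lia.
  by apply: B_diag; lia.
Qed.

(** In each summand the weights of Y(i,p) and a(p)^-1 cancel, so only the last factor a(j)
    counts. *)
Lemma add_row_qcomm x (w : nat -> K) : (forall p, (p < n)%N -> w p != 0) ->
    (forall p, (p < n)%N -> qcomm (w p) x (a p)) ->
    (forall i p, (i < m)%N -> (p < n)%N -> qcomm (w p) x (Y i p)) ->
  forall i p, (i < m.+1)%N -> (p < n)%N -> qcomm (w p) x (add_row a a' Y i p).
Proof.
move=> w0 xa xY [|i] j im jn /=; first exact: xa.
rewrite -[w j]mul1r; apply: qcommMr (xa _ jn).
rewrite big_nat; apply: qcomm_sumr => p pj; have pn : (p < n)%N by lia.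
rewrite -(divff (w0 p pn)); apply: qcommMr; first exact: xY.
by apply: (qcommVr _ (aa' pn) (a'a pn)); [apply: w0 | apply: xa].
Qed.

End AddRow.

(** ** Quantum determinants by expansion along the first row *)

Fixpoint qdet (k : nat) (M : nat -> nat -> A) : A :=
  if k is k'.+1 then
    \sum_(j < k)
      (- q) ^+ j *: (M 0%N j * qdet k' (fun i p => M i.+1 (bump j p)))
  else 1.

Lemma eq_qdet k (M N : nat -> nat -> A) :
  (forall i p, (i < k)%N -> (p < k)%N -> M i p = N i p) -> qdet k M = qdet k N.
Proof.
elim: k M N => //= k IH M N MN; apply: eq_bigr => j _.
rewrite MN //; congr (_ *: (_ * _)); apply: IH => i p ik pk.
by apply: MN => //; rewrite /bump; case: leqP; lia.
Qed.

Lemma qdet_colD k j (M N P : nat -> nat -> A) : (j < k)%N ->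
    (forall i p, (i < k)%N -> (p < k)%N -> p != j -> M i p = N i p) ->
    (forall i p, (i < k)%N -> (p < k)%N -> p != j -> M i p = P i p) ->
    (forall i, (i < k)%N -> M i j = N i j + P i j) ->
  qdet k M = qdet k N + qdet k P.
Proof.
elim: k j M N P => //= k IH j M N P jk MN MP Mj.
rewrite -big_split; apply: eq_bigr => p _ /=; rewrite -scalerDr; congr (_ *: _).
have [pj|pj] := eqVneq (p : nat) j.
  rewrite pj Mj // mulrDl; congr (_ * _ + _ * _); apply: eq_qdet => i r ik rk.
    by apply: MN; rewrite /bump; case: leqP; lia.
  by apply: MP; rewrite /bump; case: leqP; lia.
rewrite -MN // -MP // -mulrDr; congr (_ * _).
have pk := ltn_ord p; have jp : j != p by rewrite eq_sym.
(* In the minor without column p, the old column j has index [unbump p j]. *)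
have ub : bump p (unbump p j) = j by rewrite unbumpKcond (negPf jp).
apply: (IH (unbump p j)).
- by rewrite /unbump; case: ltnP => //; lia.
- move=> i r ik rk rj; apply: MN => //; first by rewrite /bump; case: leqP; lia.
  by rewrite -ub (inj_eq (can_inj (bumpK p))).
- move=> i r ik rk rj; apply: MP => //; first by rewrite /bump; case: leqP; lia.
  by rewrite -ub (inj_eq (can_inj (bumpK p))).
- by move=> i ik; rewrite ub Mj.
Qed.

(** Every monomial takes one entry from each column, so all monomials have the same weight. *)
Lemma qdet_qcomm k c (w : nat -> K) (M : nat -> nat -> A) :
    (forall i p, (i < k)%N -> (p < k)%N -> qcomm (w p) c (M i p)) ->
  qcomm (\prod_(p < k) w p) c (qdet k M).
Proof.
elim: k w M => /= [|k IH] w M cM; first by rewrite big_ord0; apply: qcomm1r.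
apply: qcomm_sumr => j _; rewrite /qcomm -scalerAr -scalerAl.
rewrite scalerA mulrC -scalerA.
congr (_ *: _); rewrite (bigD1_ord j) //=; apply: qcommMr; first exact: cM.
apply: (IH (fun p => w (bump j p))) => i p ik pk.
by apply: cM => //; rewrite /bump; case: leqP; lia.
Qed.

Lemma qdet_comm k c (M : nat -> nat -> A) :
    (forall i p, (i < k)%N -> (p < k)%N -> qcomm 1 c (M i p)) ->
  qcomm 1 c (qdet k M).
Proof. move=> cM; have := @qdet_qcomm k c (fun=> 1) M cM.
by rewrite big1_eq. Qed.

(** The factor [c] appears in the row where column j is used and must move right past entries of
    other columns in the lower rows. *)
Lemma qdet_colM k j c (M N : nat -> nat -> A) : (j < k)%N ->
    (forall i p, (i < k)%N -> (p < k)%N -> p != j -> N i p = M i p) ->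
    (forall i, (i < k)%N -> N i j = M i j * c) ->
    (forall i p, (i < k)%N -> (p < k)%N -> p != j -> qcomm 1 c (M i p)) ->
  qdet k N = qdet k M * c.
Proof.
elim: k j M N => //= k IH j M N jk NM Nj cM.
rewrite mulr_suml; apply: eq_bigr => p _ /=; rewrite -scalerAl; congr (_ *: _).
have pk := ltn_ord p.
have [pj|pj] := eqVneq (p : nat) j.
  rewrite pj Nj // -!mulrA; congr (_ * _).
  rewrite (eq_qdet (N := fun i r => M i.+1 (bump j r))); last first.
    by move=> i r ik rk; apply: NM; rewrite /bump; case: leqP; lia.
  have := @qdet_comm k c (fun i r => M i.+1 (bump j r)).
  rewrite /qcomm scale1r; apply.
  by move=> i r ik rk; apply: cM; rewrite /bump; case: leqP; lia.
rewrite NM // -mulrA; congr (_ * _).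
have jp : j != p by rewrite eq_sym.
have ub : bump p (unbump p j) = j by rewrite unbumpKcond (negPf jp).
apply: (IH (unbump p j)).
- by rewrite /unbump; case: ltnP => //; lia.
- move=> i r ik rk rj; apply: NM => //; first by rewrite /bump; case: leqP; lia.
  by rewrite -ub (inj_eq (can_inj (bumpK p))).
- by move=> i ik; rewrite ub Nj.
- move=> i r ik rk rj; apply: cM => //; first by rewrite /bump; case: leqP; lia.
  by rewrite -ub (inj_eq (can_inj (bumpK p))).
Qed.

(** Moving [c] past the minor without column j+1 costs q^-1, because column j occurs in it once.
    This offsets the extra q of the next expansion term, leaving opposite signs. The minors in the
    remaining terms still contain both columns and vanish by induction. *)
Lemma qdet_proportional_cols k j c (M : nat -> nat -> A) : (j.+1 < k)%N ->
    (forall i, (i < k)%N -> M i j.+1 = M i j * c) ->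
    (forall i p, (i < k)%N -> (p < k)%N -> p != j -> p != j.+1 ->
       qcomm 1 c (M i p)) ->
    (forall i, (i < k)%N -> qcomm q^-1 c (M i j)) ->
  qdet k M = 0.
Proof.
elim: k j M => // k IH j M jk Mj cM cMj.
have jk1 : (j < k.+1)%N by lia.
rewrite /= (bigD1 (Ordinal jk1)) //= (bigD1 (Ordinal jk)) /=; last first.
  by rewrite -val_eqE /=; lia.
rewrite big1 => [|p /andP[pj pj1]].
  (* The terms of columns [j] and [j.+1] cancel. *)
  set D := qdet k (fun i p => M i.+1 (bump j.+1 p)).
  have -> : qdet k (fun i p => M i.+1 (bump j p)) = D * c.
    apply: (@qdet_colM _ j); first by lia.
    - move=> i p ik pk pj; congr (M _ _).
      by rewrite /bump; do 2![case: leqP]; lia.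
    - move=> i ik; have -> : bump j j = j.+1 by rewrite /bump leqnn.
      have -> : bump j.+1 j = j by rewrite /bump ltnn.
      by rewrite Mj.
    - by move=> i p ik pk pj; apply: cM; rewrite /bump; case: leqP; lia.
  have cD : qcomm q^-1 c D.
    have jk' : (j < k)%N by lia.
    have -> : q^-1 = \prod_(p < k) (if (p == j :> nat) then q^-1 else 1).
      rewrite (bigD1 (Ordinal jk')) //= eqxx big1 ?mulr1 // => p /negPf.
      by rewrite -val_eqE => ->.
    apply: (@qdet_qcomm k c (fun p => if p == j then q^-1 else 1)) => i p ik pk.
    case: eqP => [->|pj].
      have -> : bump j.+1 j = j by rewrite /bump ltnn.
      exact: cMj.
    by apply: cM; rewrite /bump; case: leqP; lia.
  rewrite Mj // -mulrA cD -scalerAr scalerA exprS mulrAC mulNr divff // mulN1r.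
  by rewrite scaleNr addr0 addrN.
suff -> : qdet k (fun i r => M i.+1 (bump p r)) = 0 by rewrite mulr0 scaler0.
have pk := ltn_ord p; move: pj pj1; rewrite -!val_eqE /= => pj pj1.
(* The index of column j once column p is removed. As p is neither j nor j+1, the two columns stay
   adjacent. *)
pose j' := if (p < j)%N then j.-1 else j.
have bj : bump p j' = j.
  by rewrite /bump /j'; case: (ltngtP p j) pj => // pj _; case: leqP; lia.
have bj1 : bump p j'.+1 = j.+1.
  by rewrite /bump /j'; case: (ltngtP p j) pj => // pj _; case: leqP; lia.
apply: (IH j').
- by rewrite /j'; case: ifP; lia.
- by move=> i ik; rewrite bj bj1 Mj.
- move=> i r ik rk rj rj1; apply: cM => //.
  + by rewrite /bump; case: leqP; lia.
  + by rewrite -bj (inj_eq (can_inj (bumpK p))).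
  + by rewrite -bj1 (inj_eq (can_inj (bumpK p))).
- by move=> i ik; rewrite bj; apply: cMj.
Qed.

(* The columns of [X] are replaced by those of [Z] from right to left, so that
   when column [j.+1] is treated, the columns on its right, from [Z], commute
   with [c j]. *)
Lemma qdet_column_reduction k (c : nat -> A) (X Z : nat -> nat -> A) :
    (forall i, (i < k)%N -> X i 0%N = Z i 0%N) ->
    (forall i j, (i < k)%N -> (j.+1 < k)%N ->
       X i j.+1 = Z i j.+1 + X i j * c j) ->
    (forall i j p, (i < k)%N -> (j.+1 < k)%N -> (p < j)%N ->
       qcomm 1 (c j) (X i p)) ->
    (forall i j, (i < k)%N -> (j.+1 < k)%N -> qcomm q^-1 (c j) (X i j)) ->
    (forall i j p, (i < k)%N -> (j.+1 < p < k)%N -> qcomm 1 (c j) (Z i p)) ->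
  qdet k X = qdet k Z.
Proof.
move=> X0 XS cX cXj cZ.
pose W t i p := if (p < t)%N then X i p else Z i p.
have step t : (t < k)%N -> qdet k (W t.+1) = qdet k (W t).
  case: t => [_|j jk].
    by apply: eq_qdet => i [|p] ik pk; rewrite /W //= X0.
  (* Column j+1 of [W j.+2] is that of Z plus [X i j * c j]. [P] carries the second summand, and its
     columns j and j+1 are proportional. *)
  pose P i p := if p == j.+1 then X i j * c j else W j.+1 i p.
  rewrite (@qdet_colD k j.+1 (W j.+2) (W j.+1) P) //.
  - rewrite (@qdet_proportional_cols k j (c j) P) ?addr0 //.
    + by move=> i ik; rewrite /P eqxx ltn_eqF // /W ltnSn.
    + move=> i p ik pk pj pj1; rewrite /P (negPf pj1) /W.
      by case: ltnP => pl; [apply: cX | apply: cZ]; lia.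
    + by move=> i ik; rewrite /P ltn_eqF // /W ltnSn; apply: cXj.
  - move=> i p ik pk pj; rewrite /W.
    by case: (ltnP p j.+1); case: (ltnP p j.+2) => //; lia.
  - move=> i p ik pk pj; rewrite /P (negPf pj) /W.
    by case: (ltnP p j.+1); case: (ltnP p j.+2) => //; lia.
  - by move=> i ik; rewrite /P eqxx /W ltnSn ltnn XS.
have Wt t : (t <= k)%N -> qdet k (W t) = qdet k (W 0%N).
  by elim: t => // t IH tk; rewrite step // IH // ltnW.
transitivity (qdet k (W k)).
  by apply: eq_qdet => i p ik pk; rewrite /W pk.
by rewrite Wt //; apply: eq_qdet.
Qed.

Lemma qdet_row_delta k (M : nat -> nat -> A) :
    (forall p, (p < k)%N -> M 0%N p.+1 = 0) ->
  qdet k.+1 M = M 0%N 0%N * qdet k (fun i p => M i.+1 p.+1).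
Proof.
move=> M0; rewrite /= big_ord_recl big1 => [|j _]; last first.
  by rewrite M0 ?mul0r ?scaler0.
by rewrite expr0 scale1r addr0.
Qed.

(** ** The fine q-matrix of a quantum torus *)

Definition quantum_torus (m n : nat) (T T' : nat -> nat -> A) : Prop :=
  [/\ forall i j, (i < m)%N -> (j < n)%N ->
        T i j * T' i j = 1 /\ T' i j * T i j = 1,
      forall i j k, (i < m)%N -> (j < k < n)%N -> qcomm q (T i j) (T i k),
      forall i l j, (i < l < m)%N -> (j < n)%N -> qcomm q (T i j) (T l j)
    & forall i l j k, (i < l < m)%N -> (j < n)%N -> (k < n)%N -> j != k ->
        qcomm 1 (T i j) (T l k)].

Lemma quantum_torus_behead m n T T' : quantum_torus m.+1 n T T' ->
  quantum_torus m n (fun i => T i.+1) (fun i => T' i.+1).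
Proof.
case=> h1 h2 h3 h4.
by split=> *; [apply: h1 | apply: h2 | apply: h3 | apply: h4].
Qed.

Fixpoint restore (m : nat) (T T' : nat -> nat -> A) : nat -> nat -> A :=
  if m is m'.+1 then
    add_row (T 0%N) (T' 0%N) (restore m' (fun i => T i.+1) (fun i => T' i.+1))
  else fun _ _ => 0.

Lemma restore_qcomm m n T T' x (w : nat -> K) : quantum_torus m n T T' ->
    (forall p, (p < n)%N -> w p != 0) ->
    (forall i p, (i < m)%N -> (p < n)%N -> qcomm (w p) x (T i p)) ->
  forall i p, (i < m)%N -> (p < n)%N -> qcomm (w p) x (restore m T T' i p).
Proof.
elim: m T T' => [|m IH] T T' // hT w0 xT.
have [Tinv _ _ _] := hT.
apply: (@add_row_qcomm _ n) => //.
- by move=> j jn; case: (Tinv 0%N j isT jn).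
- by move=> j jn; case: (Tinv 0%N j isT jn).
- by move=> p pn; apply: xT.
- apply: IH => //; first exact: quantum_torus_behead.
  by move=> i p im pn; apply: xT.
Qed.

(** Supplies the hypothesis [aY] of [add_row_fine]: the entry T(0,j) has weight q on column j of the
    lower rows of T and weight 1 on the other columns. *)
Lemma restore_behead_qcomm m n T T' : quantum_torus m.+1 n T T' ->
  forall j i p, (i < m)%N -> (j < n)%N -> (p < n)%N ->
  qcomm (if j == p then q else 1) (T 0%N j)
        (restore m (fun i => T i.+1) (fun i => T' i.+1) i p).
Proof.
move=> hT j i p im jn pn; have [_ _ Tcol Tcomm] := hT.
apply: (@restore_qcomm m n _ _ (T 0%N j)
  (fun p => if j == p then q else 1)) => //.
- exact: quantum_torus_behead.
- by move=> r _; case: (j == r) => //; apply: oner_neq0.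
- move=> l r lm rn; case: eqP => [<-|/eqP jr]; first exact: Tcol.
  exact: Tcomm.
Qed.

Lemma restore_fine m n T T' : quantum_torus m n T T' ->
  fine_on m n (restore m T T').
Proof.
elim: m T T' => [|m IH] T T' hT; first by split=> // i l; lia.
have [Tinv Trow _ _] := hT.
apply: add_row_fine.
- by move=> j jn; case: (Tinv 0%N j isT jn).
- by move=> j jn; case: (Tinv 0%N j isT jn).
- by move=> j k jk; apply: Trow.
- exact: restore_behead_qcomm.
- exact/IH/quantum_torus_behead.
Qed.

(** The entries T(0,j) and T(0,j+1) are entries of the top row of X, so for lower rows the relations
    of X apply: the column relation gives q^-1 at p = j, the antidiagonal relation gives 1
    elsewhere. In row 0 the row relations of T suffice. *)
Lemma restore_step_qcomm m n T T' : quantum_torus m.+1 n T T' ->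
  forall i j p, (i < m.+1)%N -> (j.+1 < n)%N -> (p <= j)%N ->
  qcomm (if p == j then q^-1 else 1) (T' 0%N j * T 0%N j.+1)
        (restore m.+1 T T' i p).
Proof.
move=> hT i j p im jn pj; have [Tinv Trow _ _] := hT.
have [_ X2 X3 _] := restore_fine hT.
have jn' : (j < n)%N by lia.
have [jj' j'j] := Tinv 0%N j isT jn'.
case: i im => [|i] im /=.
  have h : qcomm q^-1 (T 0%N j.+1) (T 0%N p).
    by apply: qcomm_sym => //; apply: Trow; lia.
  case: eqP => [->|/eqP pj']; last first.
    rewrite -(divff q0); apply: qcommMl h; rewrite -[q in qcomm q]invrK.
    apply: (qcommVl _ jj' j'j); rewrite ?invr_eq0 //.
    by apply: qcomm_sym => //; apply: Trow; lia.
  have h' : qcomm q^-1 (T 0%N j.+1) (T 0%N j).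
    by apply: qcomm_sym => //; apply: Trow; lia.
  by rewrite -[q^-1]mul1r; apply: qcommMl h'; rewrite /qcomm scale1r jj' j'j.
have h : qcomm 1 (T 0%N j.+1) (restore m.+1 T T' i.+1 p).
  by apply: (X3 0%N); lia.
rewrite -[X in qcomm X]mulr1; apply: qcommMl h.
case: eqP => [->|/eqP pj'].
  by apply: (qcommVl _ jj' j'j) => //; apply: (X2 0%N); lia.
rewrite -invr1; apply: (qcommVl _ jj' j'j); first exact: oner_neq0.
by apply: (X3 0%N); lia.
Qed.

Lemma restore_step_behead_comm m n T T' : quantum_torus m.+1 n T T' ->
  forall i j p, (i < m)%N -> (j.+1 < p < n)%N ->
  qcomm 1 (T' 0%N j * T 0%N j.+1)
        (restore m (fun i => T i.+1) (fun i => T' i.+1) i p).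
Proof.
move=> hT i j p im jp; have [Tinv _ _ _] := hT.
have jn : (j < n)%N by lia.
have [jj' j'j] := Tinv 0%N j isT jn.
rewrite -[1]mulr1; apply: qcommMl; last first.
  have := @restore_behead_qcomm m n T T' hT j.+1 i p im.
  by rewrite ltn_eqF; [apply; lia | lia].
rewrite -invr1; apply: (qcommVl _ jj' j'j); first exact: oner_neq0.
have := @restore_behead_qcomm m n T T' hT j i p im.
by rewrite ltn_eqF; [apply; lia | lia].
Qed.

Lemma restoreS_row0 m T T' j : restore m.+1 T T' 0%N j = T 0%N j.
Proof. by []. Qed.

Lemma restoreS_col0 m n T T' i : quantum_torus m.+1 n T T' -> (0 < n)%N ->
  restore m.+1 T T' i.+1 0%N
    = restore m (fun i => T i.+1) (fun i => T' i.+1) i 0%N.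
Proof.
case=> Tinv _ _ _ n0 /=; have [_ e] := Tinv 0%N 0%N isT n0.
by rewrite big_nat1 -mulrA e mulr1.
Qed.

Lemma restoreS_colS m n T T' i j : quantum_torus m.+1 n T T' -> (j.+1 < n)%N ->
  restore m.+1 T T' i.+1 j.+1
    = restore m (fun i => T i.+1) (fun i => T' i.+1) i j.+1
      + restore m.+1 T T' i.+1 j * (T' 0%N j * T 0%N j.+1).
Proof.
case=> Tinv _ _ _ jn /=; have [_ e] := Tinv 0%N j.+1 isT jn.
have jn' : (j < n)%N by lia.
have [e' _] := Tinv 0%N j isT jn'.
rewrite big_nat_recr //= mulrDl -(mulrA (restore _ _ _ _ _)) e mulr1 addrC.
by congr (_ + _); rewrite -!mulrA; congr (_ * _); rewrite mulrA e' mul1r.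
Qed.

Lemma restore_pressed_minor m n T T' r c k : quantum_torus m n T T' ->
    (r == 0)%N || (c == 0)%N -> (r + k <= m)%N -> (c + k <= n)%N ->
  qdet k (fun i p => restore m T T' (r + i) (c + p)%N)
    = \prod_(t < k) T (r + t)%N (c + t)%N.
Proof.
elim: m r c k T T' => [|m IH] r c k T T' hT rc rm cn.
  by have -> : k = 0%N by [lia]; rewrite big_ord0.
have hT1 := quantum_torus_behead hT.
case: k rm cn => [|k] rm cn; first by rewrite big_ord0.
have [Tinv _ _ _] := hT.
set Y := restore m (fun i => T i.+1) (fun i => T' i.+1).
case: r rc rm => [_|r rc] rm; last first.
  have {rc} c0 : c = 0%N by apply/eqP.
  subst c.
  (* Below row 0 the first columns of X and Y agree. As the block starts at column 0, the reduction
     replaces it by a block of Y one row higher, again pressed. *)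
  rewrite (@qdet_column_reduction _ (fun j => T' 0%N j * T 0%N j.+1) _
             (fun i p => Y (r + i)%N p)).
  - rewrite [LHS](_ : _ = qdet k.+1 (fun i p => Y (r + i)%N (0 + p)%N)) //.
    by rewrite IH //; lia.
  - by move=> i ik; rewrite addSn (restoreS_col0 _ hT) //; lia.
  - by move=> i j ik jk; rewrite addSn (restoreS_colS _ hT) //; lia.
  - move=> i j p ik jk pj.
    have := @restore_step_qcomm m n T T' hT (r.+1 + i)%N j p.
    by rewrite ltn_eqF //; apply; lia.
  - move=> i j ik jk; have := @restore_step_qcomm m n T T' hT (r.+1 + i)%N j j.
    by rewrite eqxx; apply; lia.
  - move=> i j p ik jp; apply: (@restore_step_behead_comm m n) => //; lia.
(* With r = 0 the block contains the top row, where X(0,c+j+1) = X(0,c+j) [c j], so the reduction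
   clears this row after its first entry T(0,c). What remains below and to the right is a block of Y
   starting in row 0. *)
pose Z i p := if i is i'.+1 then
    (if p is 0%N then restore m.+1 T T' i c else Y i' (c + p)%N)
  else (if p is 0%N then T 0%N c else 0).
rewrite (@qdet_column_reduction _
           (fun j => T' 0%N (c + j)%N * T 0%N (c + j).+1) _ Z).
- rewrite qdet_row_delta //= big_ord_recl /= !addn0; congr (_ * _).
  rewrite (eq_qdet (N := fun i p => Y (0 + i)%N (c.+1 + p)%N)); last first.
    by move=> i p _ _ /=; rewrite addSnnS.
  rewrite IH //; try lia.
  by apply: eq_bigr => t _; rewrite addSnnS.
- by move=> [|i] ik /=; rewrite addn0.
- move=> [|i] j ik jk; rewrite (addnS c).
    have cj : (c + j < n)%N by lia.
    by rewrite !restoreS_row0 /= add0r mulrA (proj1 (Tinv _ _ _ cj)) ?mul1r.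
  by rewrite !add0n (restoreS_colS _ hT) /Z ?addnS //; lia.
- move=> i j p ik jk pj.
  have := @restore_step_qcomm m n T T' hT i (c + j) (c + p).
  by rewrite ltn_eqF; [apply; lia | lia].
- move=> i j ik jk; have := @restore_step_qcomm m n T T' hT i (c + j) (c + j).
  by rewrite eqxx; apply; lia.
- move=> [|i] j [|p] ik jp; rewrite /Z; try lia.
    by rewrite /qcomm mulr0 mul0r scaler0.
  by apply: (@restore_step_behead_comm m n) => //; lia.
Qed.
End FineMatrices.

(** ** Expansion of q-minors *)

Lemma inversions_sum k (s : 'S_k) :
  inversions s = (\sum_(a < k) \sum_(b < k) ((a < b)%N && (s b < s a)%N))%N.
Proof.
rewrite pair_bigA /= /inversions -sum1_card big_mkcond /=.
by apply: eq_bigr => p _; rewrite inE; case: (_ && _).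
Qed.

(** The value j in position 0 exceeds exactly j later values, and inserting it keeps the order of
    the others. *)
Lemma inversions_lift_perm0 k (j : 'I_k.+1) (s : 'S_k) :
  inversions (lift_perm ord0 j s) = (j + inversions s)%N.
Proof.
rewrite !inversions_sum big_ord_recl; congr (_ + _)%N.
  rewrite big_ord_recl /= lift_perm_id add0n.
  transitivity (\sum_(b < k) (s b < j))%N.
    apply: eq_bigr => b _; rewrite lift_perm_lift /=; congr (nat_of_bool _).
    by rewrite /bump; case: leqP; lia.
  transitivity (\sum_(b < k | (b < j)%N) 1)%N.
    rewrite [RHS]big_mkcond [RHS](reindex_inj (@perm_inj _ s)).
    by apply: eq_bigr => b _; case: ltnP.
  rewrite sum1_card.
  have jk : (j <= k)%N by rewrite -ltnS.
  rewrite -[RHS](card_ord j) -(card_image (f := widen_ord jk)); last first.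
    by move=> x y /(congr1 val) /= /val_inj.
  apply: eq_card => b; rewrite unfold_in; apply/idP/imageP => [bj|[x _ ->]] /=.
    by exists (Ordinal bj) => //; apply: val_inj.
  exact: ltn_ord.
apply: eq_bigr => a _; rewrite big_ord_recl /= add0n; apply: eq_bigr => b _.
rewrite !lift_perm_lift /=; congr (nat_of_bool _); congr (_ && _).
by rewrite /bump; do 2![case: leqP]; lia.
Qed.

Lemma lift_perm0_bij k :
  bijective (fun u : 'I_k.+1 * 'S_k => lift_perm ord0 u.1 u.2).
Proof.
apply: inj_card_bij => [[i s] [j t] /= e|]; last first.
  by rewrite card_prod !card_Sn card_ord factS.
have ij : i = j.
  by have := congr1 (fun u : 'S_k.+1 => u ord0) e; rewrite /= !lift_perm_id.
subst j; congr (_, _); apply/permP => x.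
have := congr1 (fun u : 'S_k.+1 => u (lift ord0 x)) e.
by rewrite /= !lift_perm_lift => /lift_inj.
Qed.

(** No relations between entries are required: both sides multiply rows from top to bottom, and the
    Leibniz sum splits by the image j of 0. *)
Lemma leibniz_qdet (K : fieldType) (A : algType K) (q : K) k
    (M : nat -> nat -> A) :
  \sum_(s : 'S_k) (- q) ^+ inversions s *: \prod_(t < k) M t (s t) = qdet q k M.
Proof.
elim: k M => [|k IH] M.
  rewrite (bigD1 1%g) //= big_ord0 big1 ?addr0 => [|s]; last first.
    by case/negP; apply/eqP/permP => -[].
  by rewrite inversions_sum big_ord0 expr0 scale1r.
rewrite (reindex _ (onW_bij _ (lift_perm0_bij k))) /=.
rewrite -(pair_bigA _ (fun j s => (- q) ^+ inversions (lift_perm ord0 j s) *: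
  \prod_(t < k.+1) M t (lift_perm ord0 j s t))) /=.
apply: eq_bigr => j _; rewrite -IH mulr_sumr scaler_sumr; apply: eq_bigr => s _.
rewrite inversions_lift_perm0 exprD -scalerA -scalerAr big_ord_recl.
rewrite lift_perm_id.
congr (_ *: (_ *: (_ * _))); apply: eq_bigr => t _.
by rewrite lift_perm_lift.
Qed.

Lemma enum_val_interval n (I : {set 'I_n}) (a k : nat) :
    (a + k <= n)%N -> (I =i [pred i : 'I_n | a <= i < a + k])%N ->
  #|I| = k /\ forall t : 'I_#|I|, enum_val t = (a + t)%N :> nat.
Proof.
move=> akn hI.
have e : map val (enum I) = iota a k.
  apply: (irr_sorted_eq ltn_trans ltnn).
  - rewrite /enum_mem -enumT.
    apply: (subseq_sorted ltn_trans (s2 := map val (enum 'I_n))).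
      by apply: map_subseq; apply: filter_subseq.
    by rewrite val_enum_ord iota_ltn_sorted.
  - exact: iota_ltn_sorted.
  move=> x; rewrite mem_iota; apply/mapP/idP => [[i]|xa].
    by rewrite mem_enum hI => + ->.
  have xn : (x < n)%N by lia.
  by exists (Ordinal xn) => //; rewrite mem_enum hI.
have cI : #|I| = k by rewrite cardE -(size_map val) e size_iota.
split=> // t; have tk : (t < k)%N by rewrite -cI.
have x0 := enum_val t.
by rewrite (enum_val_nth x0) -(nth_map _ (val x0)) ?e ?nth_iota // -cardE.
Qed.

(** ** Quasi-commutation exponents *)

(* The pressed interval cortege with corner (i,j) (1-based) has size
   [k = minn i j]; for two intervals [l, l+k) and [l', l'+k') with [k' <= k],
   [overhang (l' - l) k k'] is the number of points of the second one beyond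
   the first one on the right, and [overhang (l - l') k' k] on the left. The
   formula is symmetric enough to give the antisymmetry of [corner_exp]
   without comparing [k] and [k']. *)
Definition overhang (e k k' : nat) : nat :=
  minn (minn k k') (minn (k' + e - k) e).

Definition interval_exp (k l k' l' : nat) : int :=
  (overhang (l' - l) k k')%:Z - (overhang (l - l') k' k)%:Z.

Definition corner_exp (i j i' j' : nat) : int :=
  let k := minn i j in let k' := minn i' j' in
  interval_exp k (i - k) k' (i' - k') + interval_exp k (j - k) k' (j' - k').

(* The exponent of T(i,j) and T(i',j') for T(i,j) = F(i,j)^-1 F(i+1,j+1). *)
Definition corner_exp_diff (i j i' j' : nat) : int :=
  corner_exp i j i' j' - corner_exp i j i'.+1 j'.+1
  - corner_exp i.+1 j.+1 i' j' + corner_exp i.+1 j.+1 i'.+1 j'.+1.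

Definition torus_exp (i j i' j' : nat) : int :=
  ((i == i') && (j < j')%N)%:Z - ((i == i') && (j' < j)%N)%:Z
  + ((j == j') && (i < i')%N)%:Z - ((j == j') && (i' < i)%N)%:Z.

Lemma overhang0 k k' : overhang 0 k k' = 0%N.
Proof. by rewrite /overhang !minn0. Qed.

Lemma overhang_le e k k' : (k <= k')%N -> overhang e k k' = minn k e.
Proof. by rewrite /overhang; lia. Qed.

Lemma overhang_ge e k k' :
  (k' <= k)%N -> overhang e k k' = minn k' (k' + e - k).
Proof. by rewrite /overhang; lia. Qed.

(** Away from the lines k = k' and k = k' + e, [overhang] is locally a function of k plus a function
    of k', which a mixed second difference kills. *)
Lemma overhang_diff e k k' :
  (overhang e k k')%:Z - (overhang e k k'.+1)%:Z
  - (overhang e k.+1 k')%:Z + (overhang e k.+1 k'.+1)%:Z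
  = ((0 < e)%N && (k == k'))%:Z - ((0 < e)%N && (k == k' + e)%N)%:Z.
Proof.
case: (ltngtP k k') => [lt|gt|<-].
- by rewrite !overhang_le; lia.
- by rewrite !overhang_ge; lia.
- rewrite (@overhang_le _ k k) // (@overhang_le _ k k.+1) //.
  by rewrite (@overhang_ge _ k.+1 k) // (@overhang_le _ k.+1 k.+1) //; lia.
Qed.

Lemma corner_exp_sym i j i' j' : corner_exp j i j' i' = corner_exp i j i' j'.
Proof. by rewrite /corner_exp (minnC j) (minnC j') addrC. Qed.

Lemma corner_exp_anti i j i' j' : corner_exp i' j' i j = - corner_exp i j i' j'.
Proof. by rewrite /corner_exp /interval_exp opprD !opprB. Qed.

(** Corners are written as size plus offset, the offset being constant along a diagonal. Here both
    row intervals start at 0, so only columns contribute. *)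
Lemma corner_exp_upper k l k' l' :
  corner_exp k (k + l) k' (k' + l')
    = (overhang (l' - l) k k')%:Z - (overhang (l - l') k' k)%:Z.
Proof.
rewrite /corner_exp !(minn_idPl (leq_addr _ _)) !subnn !addKn /interval_exp.
by rewrite !overhang0 subrr add0r.
Qed.

Lemma corner_exp_mixed k l k' l' :
  corner_exp k (k + l) (k' + l') k'
    = (overhang l' k k')%:Z - (overhang l k' k)%:Z.
Proof.
rewrite /corner_exp !(minn_idPl (leq_addr _ _)) !(minn_idPr (leq_addr _ _)).
by rewrite !subnn !addKn /interval_exp !subn0 !sub0n !overhang0 subr0 sub0r.
Qed.

Lemma corner_exp_diff_upper k l k' l' :
  corner_exp_diff k (k + l) k' (k' + l')
    = ((0 < l' - l)%N && (k == k'))%:Z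
      - ((0 < l' - l)%N && (k == k' + (l' - l))%N)%:Z
      - (((0 < l - l')%N && (k' == k))%:Z
         - ((0 < l - l')%N && (k' == k + (l - l'))%N)%:Z).
Proof.
by rewrite /corner_exp_diff -!addSn !corner_exp_upper -!overhang_diff; lia.
Qed.

Lemma corner_exp_diff_mixed k l k' l' :
  corner_exp_diff k (k + l) (k' + l') k'
    = ((0 < l')%N && (k == k'))%:Z - ((0 < l')%N && (k == k' + l')%N)%:Z
      - (((0 < l)%N && (k' == k))%:Z - ((0 < l)%N && (k' == k + l)%N)%:Z).
Proof.
by rewrite /corner_exp_diff -!addSn !corner_exp_mixed -!overhang_diff; lia.
Qed.

Lemma corner_exp_diff_sym i j i' j' :
  corner_exp_diff j i j' i' = corner_exp_diff i j i' j'.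
Proof.
rewrite /corner_exp_diff (corner_exp_sym i j) (corner_exp_sym i j).
by rewrite (corner_exp_sym i.+1) (corner_exp_sym i.+1).
Qed.

(** Transposition allows i <= j. If also i' <= j', the two lines of [overhang_diff] are equality of
    rows and equality of columns; otherwise the corners lie on opposite sides of the diagonal. *)
Lemma corner_exp_diffE i j i' j' :
  corner_exp_diff i j i' j' = torus_exp i j i' j'.
Proof.
wlog ij : i j i' j' / (i <= j)%N => [H|].
  case/orP: (leq_total i j) => ij; first exact: H.
  by rewrite -corner_exp_diff_sym H // /torus_exp; lia.
rewrite -(subnKC ij); case/orP: (leq_total i' j') => ij'; rewrite -(subnKC ij').
  rewrite corner_exp_diff_upper /torus_exp.
  move: (j - i)%N (j' - i')%N => l l'.
  by case: (ltngtP i i') => hi; case: (ltngtP l l') => hl /=;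
    rewrite ?subnn /=; lia.
rewrite corner_exp_diff_mixed /torus_exp.
move: (j - i)%N (i' - j')%N => l l'.
by case: (ltngtP i j') => hi; lia.
Qed.

(** ** Pressed interval corteges *)

Definition block (n l k : nat) : {set 'I_n} :=
  [set x : 'I_n | (l <= x < l + k)%N].

Lemma card_block n l k : (l + k <= n)%N -> #|block n l k| = k.
Proof.
move=> lk; have [|//] := @enum_val_interval n (block n l k) l k lk.
by move=> x; rewrite !inE.
Qed.

Lemma set_min_block n l k : (l + k <= n)%N -> (0 < k)%N ->
  set_min (block n l k) = l.
Proof.
move=> lk k0; have ln : (l < n)%N by lia.
apply/eqP; rewrite eqn_leq; apply/andP; split.
  have lI : Ordinal ln \in block n l k by rewrite inE /=; lia.
  have := mem_index_enum (Ordinal ln); rewrite /set_min.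
  elim: (index_enum _) => //= x s IH; rewrite inE big_cons.
  case/orP=> [/eqP <-|/IH le]; first by rewrite lI geq_min leqnn.
  by case: ifP => // _; rewrite geq_min le orbT.
rewrite /set_min; elim/big_ind: _ => [||x]; [lia | | by rewrite inE => /andP[]].
by move=> x y lx ly; rewrite leq_min lx.
Qed.

Lemma set_max_block n l k : (l + k <= n)%N -> (0 < k)%N ->
  set_max (block n l k) = (l + k).-1.
Proof.
move=> lk k0; have ln : ((l + k).-1 < n)%N by lia.
apply/eqP; rewrite eqn_leq; apply/andP; split.
  by apply/bigmax_leqP => x; rewrite inE; lia.
rewrite /set_max (bigD1 (Ordinal ln)) /=; last by rewrite inE /=; lia.
exact: leq_maxl.
Qed.

Lemma card_below_block n l k l' k' : (l + k <= n)%N -> (0 < k)%N ->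
    (l' + k' <= n)%N ->
  card_below (block n l k) (block n l' k') = (minn (l' + k') l - l')%N.
Proof.
move=> lk k0 lk'; rewrite /card_below set_min_block //.
rewrite -(@card_block n l' (minn (l' + k') l - l')); last lia.
by apply: eq_card => x; rewrite !inE; lia.
Qed.

Lemma card_above_block n l k l' k' : (l + k <= n)%N -> (0 < k)%N ->
    (l' + k' <= n)%N ->
  card_above (block n l k) (block n l' k')
    = (l' + k' - maxn (l + k) l')%N.
Proof.
move=> lk k0 lk'; rewrite /card_above set_max_block //.
have [le|gt] := leqP (maxn (l + k) l') (l' + k').
  rewrite -(@card_block n (maxn (l + k) l') (l' + k' - maxn (l + k) l'));
    last lia.
  by apply: eq_card => x; rewrite !inE; lia.
by rewrite (eqP (ltnW gt)) eq_card0 // => x; rewrite !inE; lia.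
Qed.

(** The left side is beta - alpha for rows, or delta - gamma for columns. The size condition is the
    one under which quasi-commutation is assumed. *)
Lemma block_exp k l k' l' : (k' <= k)%N ->
  (l' + k' - maxn (l + k) l')%N%:Z - (minn (l' + k') l - l')%N%:Z
    = interval_exp k l k' l'.
Proof.
by move=> le; rewrite /interval_exp overhang_ge // overhang_le //; lia.
Qed.

Lemma qminor_block (K : fieldType) (A : algType K) (q : K) m n
    (M : nat -> nat -> A) (c : cortege m n) r s k :
    rows c = block m r k -> cols c = block n s k ->
    (r + k <= m)%N -> (s + k <= n)%N ->
  qminor q (\matrix_(i < m, j < n) M i j) c
    = qdet q k (fun i p => M (r + i)%N (s + p)%N).
Proof.
move=> rc sc rm sn.
have [|ck erow] := @enum_val_interval m (rows c) r k rm.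
  by move=> x; rewrite rc inE.
have [|_ ecol] := @enum_val_interval n (cols c) s k sn.
  by move=> x; rewrite sc inE.
rewrite -[in RHS]ck -leibniz_qdet; apply: eq_bigr => w _; congr (_ *: _).
by apply: eq_bigr => t _; rewrite mxE erow ecol.
Qed.

Section Corners.
Variables m n : nat.

(** The ordinals are the 0-based last row and column; sizes and exponents use the 1-based [i.+1] and
    [j.+1]. *)
Definition corner_sets (i : 'I_m) (j : 'I_n) : {set 'I_m} * {set 'I_n} :=
  let k := minn i.+1 j.+1 in (block m (i.+1 - k) k, block n (j.+1 - k) k).

Lemma corner_subproof i j : #|(corner_sets i j).1| == #|(corner_sets i j).2|.
Proof.
by have := ltn_ord i; have := ltn_ord j => jn im; rewrite !card_block //; lia.
Qed.

Definition corner_cortege i j : cortege m n :=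
  exist _ (corner_sets i j) (corner_subproof i j).

Lemma interval_block p l k : (l + k <= p)%N -> (0 < k)%N ->
  Defs.interval (block p l k).
Proof.
move=> lk k0; have lp : (l < p)%N by lia.
have lkp : ((l + k).-1 < p)%N by lia.
apply/existsP; exists (Ordinal lp); apply/existsP; exists (Ordinal lkp).
by apply/andP; split=> /=; [lia | apply/eqP/setP => x; rewrite !inE /=; lia].
Qed.

Lemma pressed_block p k : (k <= p)%N -> pressed (block p 0 k).
Proof.
by move=> kp; rewrite /pressed card_block //; apply/eqP/setP => x; rewrite !inE.
Qed.

Lemma corner_pressed i j : pressed_interval (corner_cortege i j).
Proof.
have := ltn_ord i; have := ltn_ord j => jn im.
rewrite /pressed_interval /rows /cols /= !interval_block /=; try lia.
case: (leqP i.+1 j.+1) => ij; rewrite subnn pressed_block ?orbT //; lia.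
Qed.

Definition corner i j : pint m n :=
  exist _ (corner_cortege i j) (corner_pressed i j).

Lemma intervalP p (I : {set 'I_p}) : Defs.interval I ->
  exists a : 'I_p, exists k,
    [/\ (0 < k)%N, (k <= a.+1)%N & I = block p (a.+1 - k) k].
Proof.
case/existsP=> a /existsP[b /andP[ab /eqP ->]].
exists b, (b.+1 - a)%N; split; try lia.
by apply/setP => x; rewrite !inE; lia.
Qed.

Lemma pressed_blockP p (a : 'I_p) k : (0 < k)%N -> (k <= a.+1)%N ->
  pressed (block p (a.+1 - k) k) -> k = a.+1.
Proof.
move=> k0 ka; have ap := ltn_ord a; rewrite /pressed card_block; last lia.
have p0 : (0 < p)%N by lia.
move/eqP/setP/(_ (Ordinal p0)); rewrite !inE /= k0; lia.
Qed.

(** One of the two intervals starts at 0, so the common size is the smaller of the two 1-based right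
    ends. *)
Lemma pint_corner (p : pint m n) : exists i j, p = corner i j.
Proof.
have /and3P[/intervalP[i [k [k0 ki hI]]]
            /intervalP[j [k' [k0' kj hJ]]] pr] := svalP p.
have im := ltn_ord i; have jn := ltn_ord j.
have kk' : k = k'.
  have := card_rows_cols (sval p); rewrite hI hJ !card_block //; lia.
subst k'; have hk : k = minn i.+1 j.+1.
  case/orP: pr; rewrite ?hI ?hJ => pr.
    by have := pressed_blockP k0 ki pr; lia.
  by have := pressed_blockP k0 kj pr; lia.
exists i, j; apply/val_inj/val_inj.
by rewrite /= /corner_sets -hk -hI -hJ; case: (p) => [[[]]].
Qed.

Lemma corner_qcomm (K : fieldType) (A : algType K) (q : K)
    (f0 : pint m n -> A) :
    q != 0 -> quasi_commuting q f0 -> 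
      forall (i : 'I_m) (j : 'I_n) (i' : 'I_m) (j' : 'I_n),
  qcomm (q ^ corner_exp i.+1 j.+1 i'.+1 j'.+1)
    (f0 (corner i j)) (f0 (corner i' j')).
Proof.
move=> q0 qc i j i' j'.
(* The hypothesis on [f0] has the larger cortege on the left; antisymmetry of [corner_exp] gives the
   other order. *)
wlog le : i j i' j' / (minn i'.+1 j'.+1 <= minn i.+1 j.+1)%N => [H|].
  case/orP: (leq_total (minn i'.+1 j'.+1) (minn i.+1 j.+1)) => le.
    exact: H.
  rewrite corner_exp_anti -invr_expz; apply: qcomm_sym; last exact: H.
  by rewrite expfz_neq0.
have [im jn im' jn'] := And4 (ltn_ord i) (ltn_ord j) (ltn_ord i') (ltn_ord j').
rewrite /qcomm qc.
  congr (q ^ _ *: _); rewrite /qc_exponent /rows /cols /= /corner_exp.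
  rewrite !card_above_block ?card_below_block; try lia.
  rewrite -!block_exp //; lia.
by rewrite /rows /= !card_block //; lia.
Qed.

End Corners.

(** ** The extension *)

Section CornerTorus.
Variables (K : fieldType) (A : algType K) (q : K) (m n : nat).
Variable f0 : pint m.+1 n.+1 -> A.
Hypotheses (q0 : q != 0) (f0_qc : quasi_commuting q f0).
Variable g0 : 'I_m.+1 * 'I_n.+1 -> A.
Hypothesis f0g0 : forall u,
  f0 (corner u.1 u.2) * g0 u = 1 /\ g0 u * f0 (corner u.1 u.2) = 1.

(** Indices are 1-based, and the border i = 0 or j = 0 carries the value 1 of the empty minor. *)
Definition corner_val (f : 'I_m.+1 * 'I_n.+1 -> A) (i j : nat) : A :=
  if i is i'.+1 then if j is j'.+1 then f (inord i', inord j') else 1 else 1.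

Let F := corner_val (fun u => f0 (corner u.1 u.2)).
Let G := corner_val g0.

Definition torus_gen (i j : nat) : A := G i j * F i.+1 j.+1.
Definition torus_gen_inv (i j : nat) : A := G i.+1 j.+1 * F i j.

Let FG i j : F i j * G i j = 1 /\ G i j * F i j = 1.
Proof.
rewrite /F /G; case: i j => [|i] [|j] /=; rewrite ?mulr1 //.
exact: (f0g0 (inord i, inord j)).
Qed.

Lemma corner_val_qcomm i j i' j' : (i <= m.+1)%N -> (j <= n.+1)%N ->
    (i' <= m.+1)%N -> (j' <= n.+1)%N ->
  qcomm (q ^ corner_exp i j i' j') (F i j) (F i' j').
Proof.
(* A border corner has size 0, hence exponent 0, consistently with its value 1. *)
have exp0l k l : (k == 0)%N || (l == 0)%N ->
    forall k' l', corner_exp k l k' l' = 0.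
  move=> kl k' l'; have kl0 : minn k l = 0%N by lia.
  by rewrite /corner_exp kl0 /interval_exp /overhang ?(min0n, minn0).
have F0 k l : (k == 0)%N || (l == 0)%N -> F k l = 1 by case: k l => [|k] [|l].
move=> im jn im' jn'.
have [ij|ij] := boolP ((i == 0)%N || (j == 0)%N).
  by rewrite F0 // exp0l // expr0z; apply: qcomm1l.
have [ij'|ij'] := boolP ((i' == 0)%N || (j' == 0)%N).
  by rewrite corner_exp_anti (F0 i') // exp0l // oppr0 expr0z; apply: qcomm1r.
case: i j i' j' ij ij' im jn im' jn'
  => [|i] [|j] [|i'] [|j'] // _ _ im jn im' jn'.
have := corner_qcomm q0 f0_qc (inord i) (inord j) (inord i') (inord j').
by rewrite !inordK.
Qed.

Lemma torus_gen_qcomm i j i' j' : (i < m.+1)%N -> (j < n.+1)%N ->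
    (i' < m.+1)%N -> (j' < n.+1)%N ->
  qcomm (q ^ torus_exp i j i' j') (torus_gen i j) (torus_gen i' j').
Proof.
move=> im jn im' jn'; rewrite -corner_exp_diffE /corner_exp_diff.
have e0 e : q ^ e != 0 by rewrite expfz_neq0.
have FF k l k' l' := @corner_val_qcomm k l k' l'.
have FG' k l k' l' : (k <= m.+1)%N -> (l <= n.+1)%N -> (k' <= m.+1)%N ->
    (l' <= n.+1)%N -> qcomm (q ^ - corner_exp k l k' l') (F k l) (G k' l').
  move=> km ln km' ln'; rewrite -invr_expz; have [h h'] := FG k' l'.
  by apply: qcommVr h h' _ => //; apply: FF.
have GV k l e y : qcomm (q ^ e) (F k l) y -> qcomm (q ^ - e) (G k l) y.
  rewrite -invr_expz; have [h h'] := FG k l; exact: qcommVl.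
(* The outer sign comes from the inverse in the left generator, the inner signs from the inverse in
   the right one. *)
have -> : corner_exp i j i' j' - corner_exp i j i'.+1 j'.+1
    - corner_exp i.+1 j.+1 i' j' + corner_exp i.+1 j.+1 i'.+1 j'.+1
  = - (- corner_exp i j i' j' + corner_exp i j i'.+1 j'.+1)
    + (- corner_exp i.+1 j.+1 i' j' + corner_exp i.+1 j.+1 i'.+1 j'.+1) by lia.
rewrite expfzDr //; apply: qcommMl.
  apply: GV; rewrite expfzDr //; apply: qcommMr; [apply: FG'|apply: FF]; lia.
by rewrite expfzDr //; apply: qcommMr; [apply: FG'|apply: FF]; lia.
Qed.

Lemma torus_gen_quantum_torus :
  quantum_torus q m.+1 n.+1 torus_gen torus_gen_inv.
Proof.
split.
- move=> i j _ _; rewrite /torus_gen /torus_gen_inv.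
  have [h1 h2] := FG i j; have [h3 h4] := FG i.+1 j.+1.
  split; rewrite -mulrA; first by rewrite (mulrA (F _ _)) h3 mul1r h2.
  by rewrite (mulrA (F _ _)) h1 mul1r h4.
- move=> i j k im jk; have := @torus_gen_qcomm i j i k im.
  have -> : torus_exp i j i k = 1 by rewrite /torus_exp; lia.
  by apply; lia.
- move=> i l j il jn; have := @torus_gen_qcomm i j l j.
  have -> : torus_exp i j l j = 1 by rewrite /torus_exp; lia.
  by apply; lia.
- move=> i l j k il jn kn jk; have := @torus_gen_qcomm i j l k.
  have -> : torus_exp i j l k = 0 by rewrite /torus_exp; lia.
  by apply; lia.
Qed.

(** The product telescopes from a border corner, where [F] is 1. *)
Lemma prod_torus_gen r c k : (r == 0)%N || (c == 0)%N ->
  \prod_(t < k) torus_gen (r + t) (c + t) = F (r + k) (c + k).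
Proof.
move=> rc; elim: k => [|k IH].
  by rewrite big_ord0 !addn0; case: r c rc => [|r] [|c].
rewrite big_ord_recr /= IH /torus_gen mulrA (proj1 (FG _ _)) mul1r.
by rewrite -!addnS.
Qed.

Definition corner_extension : 'M[A]_(m.+1, n.+1) :=
  \matrix_(i, j) restore m.+1 torus_gen torus_gen_inv i j.

Lemma corner_extension_fine : fine_qmatrix q corner_extension.
Proof.
have [X1 X2 X3 X4] := restore_fine q0 torus_gen_quantum_torus.
split=> [i j k jk|i l j il|i l j k il jk|i l j k il jk]; rewrite !mxE.
- by apply: X1; rewrite ?jk ?ltn_ord.
- by apply: X2; rewrite ?il ?ltn_ord.
- by rewrite X3 ?scale1r ?il ?jk ?ltn_ord.
- by apply: X4; rewrite ?il ?jk ?ltn_ord.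
Qed.

Lemma qminor_corner_extension (p : pint m.+1 n.+1) :
  qminor q corner_extension p = f0 p.
Proof.
have [i [j ->]] := pint_corner p.
have im := ltn_ord i; have jn := ltn_ord j; pose k := minn i.+1 j.+1.
rewrite (@qminor_block _ _ _ _ _ _ _ (i.+1 - k) (j.+1 - k) k); try lia; try by [].
rewrite (@restore_pressed_minor _ _ _ q0 _ n.+1); try (rewrite /k; lia).
  rewrite prod_torus_gen; last by rewrite /k; lia.
  rewrite !subnK ?geq_minl ?geq_minr //.
  by rewrite /F /corner_val !inord_val.
exact: torus_gen_quantum_torus.
Qed.

Lemma qminor_corner_extension0 :
  qminor q corner_extension (cortege0 m.+1 n.+1) = 1.
Proof. by rewrite (@qminor_block _ _ _ _ _ _ _ 0 0 0). Qed.

End CornerTorus.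

Theorem theorem1p2 (m n : nat) (hm : (1 <= m)%N) (hn : (1 <= n)%N)
    (K : fieldType) (q : K) (hq : q != 0) (A : algType K)
    (f0 : pint m n -> A)
    (f0_inv : forall p : pint m n, invertible (f0 p))
    (f0_qc : quasi_commuting q f0) :
  exists f : cortege m n -> A,
    QI_function q f /\ forall p : pint m n, f p = f0 p.
Proof.
case: m n hm hn f0 f0_inv f0_qc => [|m'] [|n'] // _ _ f1 f1_inv f1_qc.
have [g0 f1g0] : exists g0 : 'I_m'.+1 * 'I_n'.+1 -> A, forall u,
    f1 (corner u.1 u.2) * g0 u = 1 /\ g0 u * f1 (corner u.1 u.2) = 1.
  (* Inverses are chosen for all corners at once, over a finite index type. *)
  apply: (@fin_all_exists _ (fun=> A) (fun u b =>
    f1 (corner u.1 u.2) * b = 1 /\ b * f1 (corner u.1 u.2) = 1)) => u.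
  exact: f1_inv.
exists (qminor q (corner_extension f1 g0)).
split; last by move=> p; apply: qminor_corner_extension.
split; first exact: qminor_corner_extension0.
by move=> N e [_ e_holds]; apply: e_holds => //; apply: corner_extension_fine.
Qed.
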